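(* (Spherically symmetric rigid body.) Let $C,I>0$. On $\mathbb{R}_{>0}\times\mathfrak{so}_3$ with coordinates $(\beta,\omega)$ put $$r=-\beta\omega\in\mathfrak{so}_3,\qquad E=\frac C\beta+\frac12I\omega^2,\qquad M=I\langle\omega,\cdot\rangle\in\mathfrak{so}_3^*,$$ and let $$g=-d\beta\otimes dE-\langle dr\otimes dM\rangle ,$$ where $\langle dr\otimes dM\rangle$ denotes the tensor product of forms composed with the duality pairing $\mathfrak{so}_3\otimes\mathfrak{so}_3^*\to\mathbb{R}$. Then, with $\tilde u=2\sqrt{C/\beta}$ and $\tilde\omega=\sqrt I\,\omega$, $$g=\frac{4C}{\tilde u^2}\big(d\tilde u\otimes d\tilde u+\langle d\tilde\omega\otimes d\tilde\omega\rangle\big),$$ so that $(\mathbb{R}_{>0}\times\mathfrak{so}_3,g)$ is isometric to the $4$-dimensional hyperbolic (upper half-)space of constant sectional curvature $-\frac1{4C}$.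
   Context: $\mathfrak{so}_3$ is the Lie algebra of skew-symmetric real $3\times3$ matrices with the inner product $\langle A,B\rangle=-\tfrac12\operatorname{tr}(AB)$, $\omega^2=\langle\omega,\omega\rangle$; $\langle d\tilde\omega\otimes d\tilde\omega\rangle=\sum_i d\tilde\omega_i\otimes d\tilde\omega_i$ for components in an orthonormal basis of $\mathfrak{so}_3$. *)

(* Defs.v *)
From HB Require Import structures.
From mathcomp Require Import all_boot all_order all_algebra.
From mathcomp Require Import all_classical all_reals all_analysis.

Set Implicit Arguments.
Unset Strict Implicit.
Unset Printing Implicit Defensive.

Import Order.TTheory GRing.Theory Num.Theory.
Import numFieldNormedType.Exports.

Local Open Scope classical_set_scope.
Local Open Scope ring_scope.

Section SkewMatrices.
Variable R : realType.

Definition skew_mx : {pred 'M[R]_3} := fun A => A^T == - A.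

Fact skew_mx_submod_closed : submod_closed skew_mx.
Proof.
split=> [|a A B]; first by rewrite unfold_in trmx0 oppr0.
rewrite !unfold_in => /eqP hA /eqP hB.
by rewrite linearP /= hA hB opprD scalerN.
Qed.

HB.instance Definition _ :=
  GRing.isSubmodClosed.Build R 'M[R]_3 skew_mx skew_mx_submod_closed.

Record so3 := SO3 { so3_mx :> 'M[R]_3; _ : so3_mx \in skew_mx }.

HB.instance Definition _ := [isSub for so3_mx].
HB.instance Definition _ := [Choice of so3 by <:].
HB.instance Definition _ := [SubChoice_isSubZmodule of so3 by <:].
HB.instance Definition _ := [SubZmodule_isSubLmodule of so3 by <:].

(* The norm inherited from 'M[R]_3 is the sup norm, not the one attached to
   the inner product so3_dot; it only serves to differentiate on so3, and all
   norms on a finite-dimensional space give the same differentials. *)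
Definition so3_norm (A : so3) : R := `|so3_mx A|.

Fact so3_ler_normD (A B : so3) : so3_norm (A + B) <= so3_norm A + so3_norm B.
Proof. exact: ler_normD. Qed.

Fact so3_normrZ (a : R) (A : so3) : so3_norm (a *: A) = `|a| * so3_norm A.
Proof. exact: normrZ. Qed.

Fact so3_normr0_eq0 (A : so3) : so3_norm A = 0 -> A = 0.
Proof. by move=> /normr0_eq0 A0; apply: val_inj. Qed.

HB.instance Definition _ :=
  Lmodule_isNormed.Build R so3 so3_ler_normD so3_normrZ so3_normr0_eq0.

Definition so3_dot (A B : so3) : R := - 2^-1 * \tr (so3_mx A *m so3_mx B).

Fact so3_dot_is_linear (A : so3) : linear (so3_dot A).
Proof.
move=> a B B'; rewrite /so3_dot /= mulmxDr -scalemxAr mxtraceD mxtraceZ.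
by rewrite mulrDr mulrCA.
Qed.

HB.instance Definition _ (A : so3) :=
  GRing.isLinear.Build R so3 R _ (so3_dot A) (so3_dot_is_linear A).

Definition orthonormal_basis (e : 'I_3 -> so3) : Prop :=
  (forall i j, so3_dot (e i) (e j) = (i == j)%:R) /\
  (forall A, exists a : 'I_3 -> R, A = \sum_i a i *: e i).

Definition so3_dual := {linear so3 -> R}.

End SkewMatrices.

Section RiemannianMetrics.
Variable R : realType.

(* U is meant to be open; f is C^k on U when f is differentiable at the points
   of U and all p |-> 'd f p v are C^(k-1), which for finite-dimensional V is
   the usual notion. *)
Fixpoint Ck_on (V W : normedModType R) (k : nat) (U : set V) (f : V -> W) :
    Prop :=
  if k is k'.+1 then
    (forall p, U p -> differentiable f p) /\
    (forall v, Ck_on k' U (fun p => 'd f p v))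
  else forall p, U p -> {for p, continuous f}.

Definition smooth_on (V W : normedModType R) (U : set V) (f : V -> W) : Prop :=
  forall k, Ck_on k U f.

(* A 2-tensor on an open subset of V: at p it sends a pair of tangent vectors,
   i.e. of elements of V, to a scalar. *)
Definition tensor2 (V : normedModType R) := V -> V -> V -> R.

Definition riemannian_metric (V : normedModType R) (U : set V) (g : tensor2 V)
    : Prop :=
  [/\ forall p, U p -> forall a u v w,
        g p (a *: u + v) w = a * g p u w + g p v w,
      forall p, U p -> forall v w, g p v w = g p w v,
      forall p, U p -> forall v, v != 0 -> 0 < g p v v
    & forall v w, smooth_on U (fun p => g p v w)].

Definition isometric (V W : normedModType R)
    (U : set V) (g : tensor2 V) (U' : set W) (g' : tensor2 W) : Prop :=
  [/\ riemannian_metric U g, riemannian_metric U' g'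
    & exists (f : V -> W) (f' : W -> V),
      [/\ smooth_on U f /\ smooth_on U' f',
          (forall p, U p -> U' (f p)) /\ (forall q, U' q -> U (f' q)),
          (forall p, U p -> f' (f p) = p) /\ (forall q, U' q -> f (f' q) = q)
        & forall p, U p -> forall v w,
            g' (f p) ('d f p v) ('d f p w) = g p v w]].

End RiemannianMetrics.

(* Curvature of a metric h on an open subset of R^(n+1), in the standard
   coordinates. *)
Section Curvature.
Variables (R : realType) (n : nat).
Local Notation V := 'rV[R]_n.+1.
Local Notation idx := 'I_n.+1.
Variable h : tensor2 V.

Definition coord_vec (i : idx) : V := delta_mx 0 i.

Definition partial (i : idx) (f : V -> R) (y : V) : R := 'D_(coord_vec i) f y.

Definition gram (y : V) : 'M[R]_n.+1 :=
  \matrix_(i, j) h y (coord_vec i) (coord_vec j).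

(* Gamma^k_(ij) *)
Definition christoffel (k i j : idx) (y : V) : R :=
  2^-1 * \sum_l invmx (gram y) k l *
    (partial i (fun z => gram z j l) y + partial j (fun z => gram z i l) y
     - partial l (fun z => gram z i j) y).

(* The l-th component of R(d_i, d_j) d_k, with the convention
   R(X, Y) Z = nabla_X nabla_Y Z - nabla_Y nabla_X Z - nabla_[X, Y] Z. *)
Definition riemann (l i j k : idx) (y : V) : R :=
  partial i (christoffel l j k) y - partial j (christoffel l i k) y
  + \sum_m (christoffel m j k y * christoffel l i m y
            - christoffel m i k y * christoffel l j m y).

Definition curvature_vec (y u v w : V) : V :=
  \row_l \sum_i \sum_j \sum_k u 0 i * v 0 j * w 0 k * riemann l i j k y.

Definition sectional_curvature (y v w : V) : R :=
  h y (curvature_vec y v w w) v / (h y v v * h y w w - h y v w ^+ 2).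

Definition constant_sectional_curvature (U : set V) (kappa : R) : Prop :=
  forall y, U y -> forall v w : V, row_free (col_mx v w) ->
    sectional_curvature y v w = kappa.

End Curvature.

Section HalfSpace.
Variables (R : realType) (n : nat).

Definition half_space : set 'rV[R]_n.+1 := [set y | 0 < y 0 0].

(* The upper half-space model rescaled to curvature kappa < 0:
   (dy_0^2 + ... + dy_n^2) / (- kappa y_0^2). *)
Definition half_space_metric (kappa : R) : tensor2 'rV[R]_n.+1 :=
  fun y v w => (- kappa * y 0 0 ^+ 2)^-1 * \sum_i v 0 i * w 0 i.

End HalfSpace.

Section RigidBody.
Variables (R : realType) (C I : R).
Local Notation V := (R * so3 R)%type.

Definition body_space : set V := [set p | 0 < p.1].

(* The functions of the point p = (beta, omega) below are only meaningful on
   body_space. *)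
Definition body_beta (p : V) : R := p.1.

Definition body_r (p : V) : so3 R := - (p.1 *: p.2).

Definition body_E (p : V) : R := C / p.1 + 2^-1 * I * so3_dot p.2 p.2.

Definition body_M_fun (p : V) (xi : so3 R) : R := I * so3_dot p.2 xi.

Fact body_M_fun_is_linear (p : V) : linear (body_M_fun p).
Proof. by move=> a x y; rewrite /body_M_fun linearP mulrDr mulrCA. Qed.

HB.instance Definition _ (p : V) :=
  GRing.isLinear.Build R (so3 R) R _ (body_M_fun p) (body_M_fun_is_linear p).

Definition body_M (p : V) : so3_dual R := body_M_fun p.

(* The value on w of the differential of a map N into so_3^*: the functional
   obtained by differentiating N pointwise. *)
Definition diff_dual (N : V -> so3_dual R) (p w : V) : so3 R -> R :=
  fun xi => 'd (fun q => N q xi : R) p w.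

Definition body_metric : tensor2 V := fun p v w =>
  - ('d body_beta p v * 'd body_E p w) - diff_dual body_M p w ('d body_r p v).

Definition body_u (p : V) : R := 2 * Num.sqrt (C / p.1).

Definition body_omega (p : V) : so3 R := Num.sqrt I *: p.2.

End RigidBody.

(* Main.v *)
Require Import Defs.
From HB Require Import structures.
From mathcomp Require Import all_boot all_order all_algebra.
From mathcomp Require Import all_classical all_reals all_analysis.
From mathcomp Require Import ring.

(* With u = body_u and <.,.> = so3_dot, the cross terms d beta (x) <omega, d omega>
   of - d beta (x) dE and of - <dr (x) dM> cancel, which leaves
     g = C / beta^2 d beta^2 + I beta <d omega, d omega>.
   Since u^2 = 4 C / beta, one has du = - u / (2 beta) d beta, and the conformal
   form of g follows; u together with the coordinates of sqrt I omega in an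
   orthonormal basis is then an isometry onto the half-space.  The recurrence
   du = - u / (2 beta) d beta also gives the smoothness of u, by induction on the
   order of differentiability.
   For the curvature, with symbols c^k_ij = d_ki d_j0 + d_kj d_i0 - d_ij d_k0
   built from Kronecker deltas, Gamma^k_ij = - c^k_ij / y_0; contracting with c
   collapses the Riemann tensor R^l_ijk to
   - (d_li d_jk - d_lj d_ik) / y_0^2. *)

Set Implicit Arguments.
Unset Strict Implicit.
Unset Printing Implicit Defensive.
Import Order.TTheory GRing.Theory Num.Theory.
Import numFieldNormedType.Exports.
Local Open Scope classical_set_scope.
Local Open Scope ring_scope.

(** * Differentials of linear, locally equal and scaled maps *)

Lemma is_diff_linear (R : numFieldType) (V W : normedModType R) (f : V -> W)
    (p : V) : linear f -> continuous f -> is_diff p f f.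
Proof.
move=> lf cf.
pose fM := GRing.isLinear.Build _ _ _ _ f lf.
pose fL : {linear V -> W} := HB.pack f fM.
split; first exact: (@linear_differentiable _ _ _ fL).
exact: (@diff_lin _ _ _ fL).
Qed.

(** Differentiability at [p] is a first-order expansion up to little-o, which only sees values near
    [p]. The expansion of [f] is therefore one of [g], and uniqueness of the differential identifies
    the linear part. *)
Lemma near_is_diff (R : numFieldType) (V W : normedModType R) (f g : V -> W)
    (df : V -> W) (p : V) :
  {near p, f =1 g} -> is_diff p f df -> is_diff p g df.
Proof.
move=> fg [dfp <-].
have cdf : continuous ('d f p) by exact: diff_continuous.
have Eg : g \o shift p = cst (g p) + 'd f p +o_ 0 id.
  apply/eqaddoP => e e0.
  have /eqaddoP /(_ e e0) := diff_locally dfp.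
  apply: filterS2 => [h|].
    2: by move: fg; rewrite (near_shift 0) subr0; apply.
  by rewrite /= !fctE /= /cst (nbhs_singleton fg) => <-.
split; last exact: diff_unique.
by apply/diff_locallyP; rewrite (diff_unique cdf Eg).
Qed.

(** Registering scaling as a bilinear map makes the general differential of bilinear maps available;
    the product rule [is_diff_scale] is obtained from it by the chain rule. *)
Lemma scale_is_bilinear (R : numFieldType) (W : lmodType R) :
  bilinear_for (GRing.Scale.Law.clone _ _ *:%R _)
    (GRing.Scale.Law.clone _ _ *:%R _) ( *:%R : R -> W -> W).
Proof.
split=> [w|k] a x y /=; first by rewrite scalerDl scalerA.
by rewrite scalerDr !scalerA mulrC.
Qed.

HB.instance Definition _ (R : numFieldType) (W : lmodType R) :=
  bilinear_isBilinear.Build R R W W _ _ ( *:%R : R -> W -> W)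
    (@scale_is_bilinear R W).

Lemma is_diff_scale (R : numFieldType) (V W : normedModType R) (k dk : V -> R)
    (f df : V -> W) (p : V) : is_diff p k dk -> is_diff p f df ->
  is_diff p (fun q => k q *: f q) (fun v => k p *: df v + dk v *: f p).
Proof.
move=> kp fp.
have cs : continuous (fun q : R * W => q.1 *: q.2).
  by move=> q; exact: scale_continuous.
have sp (q : R * W) :
    is_diff q (fun q => q.1 *: q.2) (fun r => q.1 *: r.2 + r.1 *: q.2).
  split; first exact: (@differentiable_bilin _ _ _ _ *:%R).
  exact: (@diff_bilin _ _ _ _ *:%R).
exact: (@is_diff_comp _ _ _ _ (fun q => (k q, f q)) _ (fun q => q.1 *: q.2)).
Qed.

(** * Smooth maps between normed spaces *)

Section SmoothMaps.
Variable R : realType.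
Implicit Types V W : normedModType R.

Lemma open_near V (U : set V) (P : V -> Prop) (p : V) : open U -> U p ->
  (forall q, U q -> P q) -> \near p, P p.
Proof.
by move=> oU Up UP; apply: filterS UP _; exact: open_nbhs_nbhs.
Qed.

(** Since [U] is open, equality on [U] is equality near each of its points, so it passes to the
    differentials and the induction on [k] goes through. *)
Lemma Ck_on_ext V W k (U : set V) (f g : V -> W) : open U ->
  (forall p, U p -> f p = g p) -> Ck_on k U f -> Ck_on k U g.
Proof.
move=> oU; elim: k f g => [|k IH] f g fg /= Cf.
  move=> p Up; have cf := Cf p Up.
  rewrite /prop_for /continuous_at -fg //; apply: cvg_trans cf.
  by apply: near_eq_cvg; apply: open_near oU Up _.
case: Cf => df Cf.
have Dg p : U p -> is_diff p g ('d f p).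
  move=> Up; apply: near_is_diff (differentiableP (df p Up)).
  exact: open_near oU Up fg.
split=> [p /Dg [] //|v]; apply: IH (Cf v) => p /Dg Dgp.
by rewrite diff_val.
Qed.

Lemma Ck_onS V W k (U : set V) (f : V -> W) :
  Ck_on k.+1 U f -> Ck_on k U f.
Proof.
elim: k f => [|k IH] f [df Cf].
  by move=> p /df; exact: differentiable_continuous.
by split=> // v; exact/IH/Cf.
Qed.

(** Allows a closed formula [df] for the differential that is valid on [U] only, whereas [Ck_on]
    speaks of the total function ['d f]. *)
Lemma Ck_on_diff V W k (U : set V) (f : V -> W) (df : V -> V -> W) : open U ->
  (forall p, U p -> is_diff p f (df p)) ->
  (forall v, Ck_on k U (df ^~ v)) -> Ck_on k.+1 U f.
Proof.
move=> oU Df Cdf; split=> [p /Df [] //|v].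
by apply: Ck_on_ext (Cdf v) => // p /Df Dfp; rewrite diff_val.
Qed.

(** Bootstrap: when the differential of [f] is expressed through [f] itself, regularity of order [k]
    for [f] passes to its differential and so gives order [k + 1]. It serves for inverses and for
    [body_u]. *)
Lemma smooth_on_diff V W (U : set V) (f : V -> W) (df : V -> V -> W) :
  open U -> (forall p, U p -> is_diff p f (df p)) ->
  (forall k, Ck_on k U f -> forall v, Ck_on k U (df ^~ v)) -> smooth_on U f.
Proof.
move=> oU Df Cdf; elim=> [|k IH]; last exact/Ck_on_diff/Cdf.
by move=> p /Df [+ _]; exact: differentiable_continuous.
Qed.

Lemma Ck_on_cst V W k (U : set V) (c : W) : Ck_on k U (fun=> c).
Proof.
elim: k c => [|k IH] c; first by move=> p _; exact: cst_continuous.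
split=> [p _|v]; first exact: differentiable_cst.
suff -> : (fun p => 'd (fun=> c) p v) = fun=> 0 by exact: IH.
by apply/funext => p; rewrite (diff_cst c p).
Qed.

Lemma smooth_on_linear V W (U : set V) (f : V -> W) :
  linear f -> continuous f -> smooth_on U f.
Proof.
move=> lf cf [|k]; first by move=> p _; exact: cf.
have D p := is_diff_linear p lf cf.
split=> [p _|v]; first by case: (D p).
suff -> : (fun p => 'd f p v) = fun=> f v by exact: Ck_on_cst.
by apply/funext => p; rewrite diff_val.
Qed.

Lemma Ck_onD V W k (U : set V) (f g : V -> W) : open U ->
  Ck_on k U f -> Ck_on k U g -> Ck_on k U (fun p => f p + g p).
Proof.
move=> oU; elim: k f g => [|k IH] f g.
  by move=> cf cg p Up; apply: continuousD; [exact: cf|exact: cg].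
move=> [df Cf] [dg Cg].
apply: (@Ck_on_diff _ _ _ _ _ (fun p v => 'd f p v + 'd g p v)) => //.
  move=> p Up; apply: is_diffD; apply: differentiableP; [exact: df|exact: dg].
by move=> v; apply: IH; [exact: Cf|exact: Cg].
Qed.

Lemma Ck_onZ V W k (U : set V) (f : V -> R) (g : V -> W) : open U ->
  Ck_on k U f -> Ck_on k U g -> Ck_on k U (fun p => f p *: g p).
Proof.
move=> oU; elim: k f g => [|k IH] f g.
  by move=> cf cg p Up; apply: continuousZ; [exact: cf|exact: cg].
move=> Cf Cg; have [df Cdf] := Cf; have [dg Cdg] := Cg.
apply: (@Ck_on_diff _ _ _ _ _ (fun p v => f p *: 'd g p v + 'd f p v *: g p))
  => //.
  move=> p Up; apply: is_diff_scale; apply: differentiableP;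
    [exact: df|exact: dg].
(* In each Leibniz term one factor is not differentiated; its order is lowered from [k + 1] to
   [k]. *)
by move=> v; apply: (Ck_onD oU); apply: IH;
  [exact: Ck_onS|exact: Cdg|exact: Cdf|exact: Ck_onS].
Qed.

Lemma smooth_on_ext V W (U : set V) (f g : V -> W) : open U ->
  (forall p, U p -> f p = g p) -> smooth_on U f -> smooth_on U g.
Proof. by move=> oU fg sf k; exact: Ck_on_ext (sf k). Qed.

Lemma smooth_on_cst V W (U : set V) (c : W) : smooth_on U (fun=> c).
Proof. by move=> k; exact: Ck_on_cst. Qed.

Lemma smooth_onD V W (U : set V) (f g : V -> W) : open U ->
  smooth_on U f -> smooth_on U g -> smooth_on U (fun p => f p + g p).
Proof. by move=> oU sf sg k; exact: Ck_onD. Qed.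

Lemma smooth_on_sum V W n (U : set V) (f : 'I_n -> V -> W) : open U ->
  (forall i, smooth_on U (f i)) -> smooth_on U (fun p => \sum_i f i p).
Proof.
move=> oU sf; suff H (s : seq 'I_n) : smooth_on U (fun p => \sum_(i <- s) f i p).
  exact: H.
elim: s => [|i s IH].
  by under eq_fun do rewrite big_nil; exact: smooth_on_cst.
by under eq_fun do rewrite big_cons; exact: smooth_onD.
Qed.

Lemma smooth_onZ V W (U : set V) (f : V -> R) (g : V -> W) : open U ->
  smooth_on U f -> smooth_on U g -> smooth_on U (fun p => f p *: g p).
Proof. by move=> oU sf sg k; exact: Ck_onZ. Qed.

Lemma smooth_onM V (U : set V) (f g : V -> R) : open U ->
  smooth_on U f -> smooth_on U g -> smooth_on U (fun p => f p * g p).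
Proof. exact: smooth_onZ. Qed.

Lemma is_diffV V (f df : V -> R) (p : V) : f p != 0 -> is_diff p f df ->
  is_diff p (fun q => (f q)^-1) (fun v => - (f p)^-1 ^+ 2 * df v).
Proof.
move=> fp0 Dfp; split; first exact: differentiableV.
by rewrite diffV// diff_val exprVn.
Qed.

Lemma smooth_onV V (U : set V) (f : V -> R) : open U ->
  (forall p, U p -> f p != 0) -> smooth_on U f ->
  smooth_on U (fun p => (f p)^-1).
Proof.
move=> oU f0 sf.
apply: (@smooth_on_diff _ _ _ _ (fun p v => - (f p)^-1 ^+ 2 * 'd f p v)) => //.
  move=> p Up; apply: (is_diffV (f0 p Up)); apply: differentiableP.
  by have [df _] := sf 1%N; exact: df.
move=> k Ck v; have [_ /(_ v) Cdf] := sf k.+1.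
(* Written as iterated scalings, the differential has factors [(f p)^-1], of order [k] by the
   bootstrap hypothesis, and ['d f p v], of order [k] because [f] has order [k + 1]. *)
apply: (@Ck_on_ext _ _ _ _
  (fun p => -1 *: ((f p)^-1 *: ((f p)^-1 *: 'd f p v)))) => //.
  by move=> p _; rewrite scaleN1r expr2 mulNr -mulrA.
apply: (Ck_onZ oU); first exact: Ck_on_cst.
by apply: (Ck_onZ oU) => //; apply: (Ck_onZ oU) => //; exact: Cdf.
Qed.

End SmoothMaps.

(** * Finite sums, row vectors and pairs of maps *)

Section Families.
Variable R : realType.
Implicit Types V W : normedModType R.

Lemma is_diff_sum V W n (f df : 'I_n -> V -> W) (p : V) :
  (forall i, is_diff p (f i) (df i)) ->
  is_diff p (fun q => \sum_i f i q) (fun v => \sum_i df i v).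
Proof.
move=> Df; suff H (s : seq 'I_n) :
    is_diff p (fun q => \sum_(i <- s) f i q) (fun v => \sum_(i <- s) df i v).
  exact: H.
elim: s => [|i s IH].
  have -> : (fun q => \sum_(i <- [::]) f i q) = cst 0.
    by apply/funext => q; rewrite big_nil.
  have -> : (fun v => \sum_(i <- [::]) df i v) = 0.
    by apply/funext => q; rewrite big_nil.
  exact: is_diff_cst.
under eq_fun do rewrite big_cons.
under [X in is_diff _ _ X]eq_fun do rewrite big_cons.
exact: is_diffD.
Qed.

Lemma row_sum_coord n (f : 'I_n.+1 -> R) :
  \row_j f j = \sum_j f j *: coord_vec R j.
Proof.
rewrite [LHS]row_sum_delta.
by apply: eq_bigr => j _; rewrite mxE.
Qed.

Lemma is_diff_row V n (f df : 'I_n.+1 -> V -> R) (p : V) :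
  (forall j, is_diff p (f j) (df j)) ->
  is_diff p (fun q => \row_j f j q) (fun v => \row_j df j v).
Proof.
move=> Df.
under eq_fun do rewrite row_sum_coord.
under [X in is_diff _ _ X]eq_fun do rewrite row_sum_coord.
apply: is_diff_sum => j.
apply: (is_diff_eq (is_diff_scale (Df j) (is_diff_cst (coord_vec R j) p))).
apply/funext => v.
(* The differential of the constant coordinate vector is zero, so only the term with [df j]
   remains. *)
by rewrite -[X in _ *: X + _]/(0 : 'rV[R]_n.+1) scaler0 add0r.
Qed.

Lemma smooth_on_row V n (U : set V) (f : 'I_n.+1 -> V -> R) : open U ->
  (forall j, smooth_on U (f j)) -> smooth_on U (fun p => \row_j f j p).
Proof.
move=> oU sf; under eq_fun do rewrite row_sum_coord.
by apply: smooth_on_sum => // j; apply: smooth_onZ => //; exact: smooth_on_cst.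
Qed.

Lemma Ck_on_pair V W W' k (U : set V) (f : V -> W) (g : V -> W') : open U ->
  Ck_on k U f -> Ck_on k U g -> Ck_on k U (fun p => (f p, g p)).
Proof.
move=> oU; elim: k f g => [|k IH] f g.
  by move=> cf cg p Up; apply: cvg_pair; [exact: cf|exact: cg].
move=> [df Cf] [dg Cg].
apply: (@Ck_on_diff _ _ _ _ _ _ (fun p v => ('d f p v, 'd g p v))) => //.
  move=> p Up; apply: is_diff_pair; apply: differentiableP;
    [exact: df|exact: dg].
by move=> v; apply: IH; [exact: Cf|exact: Cg].
Qed.

Lemma smooth_on_pair V W W' (U : set V) (f : V -> W) (g : V -> W') : open U ->
  smooth_on U f -> smooth_on U g -> smooth_on U (fun p => (f p, g p)).
Proof. by move=> oU sf sg k; exact: Ck_on_pair. Qed.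

(** Turns a one-variable derivative, such as that of the square root, into a differential to which
    the chain rule applies. *)
Lemma is_derive1_is_diff (W : normedModType R) (f : R -> W) (df : W) (x : R) :
  is_derive x 1 f df -> is_diff x f ( *:%R^~ df).
Proof.
move=> [dfx <-]; split; first exact/derivable1_diffP.
by rewrite deriv1E // derive1E.
Qed.

End Families.

(** * Curvature of the half-space *)

Section HyperbolicCurvature.
Variables (R : realType) (n : nat) (kappa : R).
Hypothesis kappa_neq0 : kappa != 0.
Local Notation V := 'rV[R]_n.+1.
Local Notation h := (@half_space_metric R n kappa).

Lemma open_half_space : open (@half_space R n).
Proof.
apply: (@open_comp _ _ (fun y : V => y 0 0) [set x | 0 < x]); last exact: open_gt.
by move=> y _; exact: coord_continuous.
Qed.

Lemma is_diff_coord (j : 'I_n.+1) (y : V) :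
  is_diff y (fun z : V => z 0 j) (fun v => v 0 j).
Proof.
by apply: is_diff_linear => [a u v|]; [rewrite !mxE|exact: coord_continuous].
Qed.

Lemma partial_diff (i : 'I_n.+1) (f : V -> R) (df : V -> R) (y : V) :
  is_diff y f df -> partial i f y = df (coord_vec R i).
Proof. by move=> [dfy <-]; rewrite /partial deriveE. Qed.

Lemma partial_coordV (i : 'I_n.+1) (a : R) (y : V) : y 0 0 != 0 ->
  partial i (fun z => a * (z 0 0)^-1) y = - a * (y 0 0)^-1 ^+ 2 * (i == 0)%:R.
Proof.
move=> y0.
rewrite (partial_diff _ (is_diffZ a (is_diffV y0 (is_diff_coord 0 y)))).
rewrite -[LHS]/(a * (- (y 0 0)^-1 ^+ 2 * coord_vec R i 0 0)).
by rewrite /coord_vec mxE eqxx /= (eq_sym i); ring.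
Qed.

Lemma partial_coordXV (i : 'I_n.+1) (a : R) (y : V) : y 0 0 != 0 ->
  partial i (fun z => a * (z 0 0)^-1 ^+ 2) y =
  - (2 * a) * (y 0 0)^-1 ^+ 3 * (i == 0)%:R.
Proof.
move=> y0.
rewrite (partial_diff _
  (is_diffZ a (is_diffX 1 (is_diffV y0 (is_diff_coord 0 y))))).
rewrite -[LHS]/(a *
  (2 * (y 0 0)^-1 ^+ 1 * (- (y 0 0)^-1 ^+ 2 * coord_vec R i 0 0))).
by rewrite /coord_vec mxE eqxx /= (eq_sym i); ring.
Qed.

Lemma half_space_metric_coord (y : V) (i j : 'I_n.+1) :
  h y (coord_vec R i) (coord_vec R j) =
  (- kappa)^-1 * (i == j)%:R * (y 0 0)^-1 ^+ 2.
Proof.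
rewrite /half_space_metric invfM exprVn -!mulrA [in RHS](mulrC (_%:R)).
congr (_ * (_ * _)).
rewrite (bigD1 i) //= !mxE !eqxx /= mul1r big1 ?addr0 // => k ki.
by rewrite !mxE (negbTE ki) mul0r.
Qed.

Lemma gram_half_space (y : V) :
  gram h y = ((- kappa)^-1 * (y 0 0)^-1 ^+ 2)%:M.
Proof.
apply/matrixP => i j; rewrite !mxE half_space_metric_coord.
by rewrite -[RHS]mulr_natr mulrAC.
Qed.

Lemma invmx_gram_half_space (y : V) : y 0 0 != 0 ->
  invmx (gram h y) = (- kappa * y 0 0 ^+ 2)%:M.
Proof.
move=> y0; rewrite gram_half_space invmx_scalar.
by rewrite invfM invrK exprVn invrK.
Qed.

(* Up to the factor [- (y 0 0)^-1], the Christoffel symbols of the half-space. *)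
Definition half_space_symbol (k i j : 'I_n.+1) : R :=
  (k == i)%:R * (j == 0)%:R + (k == j)%:R * (i == 0)%:R
  - (i == j)%:R * (k == 0)%:R.

(** The Gram matrix is scalar, so only [l = k] contributes to the sum. The factor 2 from
    differentiating [y_0^-2] cancels the [2^-1], and the two powers of [kappa] cancel as well. *)
Lemma christoffel_half_space (k i j : 'I_n.+1) (y : V) : y 0 0 != 0 ->
  christoffel h k i j y = - half_space_symbol k i j * (y 0 0)^-1.
Proof.
move=> y0; rewrite /christoffel invmx_gram_half_space //.
rewrite (bigD1 k) //= big1 ?addr0 => [|l lk]; last first.
  by rewrite mxE eq_sym (negbTE lk) mulr0n mul0r.
rewrite mxE eqxx mulr1n.
have E a b : (fun z => gram h z a b) =
    (fun z => ((- kappa)^-1 * (a == b)%:R) * (z 0 0)^-1 ^+ 2).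
  by apply/funext => z; rewrite mxE half_space_metric_coord.
rewrite !E !partial_coordXV // /half_space_symbol.
rewrite (eq_sym j k) (eq_sym i k).
by field; rewrite y0 kappa_neq0.
Qed.

Lemma partial_christoffel_half_space (l k i j : 'I_n.+1) (y : V) : 0 < y 0 0 ->
  partial l (christoffel h k i j) y =
  half_space_symbol k i j * (y 0 0)^-1 ^+ 2 * (l == 0)%:R.
Proof.
move=> y0.
(* The closed form of the symbol holds where [y 0 0] is nonzero; a derivative needs it on a
   neighbourhood of [y], which the open half-space provides. *)
have E : \near y, christoffel h k i j y = - half_space_symbol k i j * (y 0 0)^-1.
  apply: (open_near open_half_space) => // z z0.
  by rewrite christoffel_half_space // gt_eqF.
rewrite [LHS](near_eq_derive _ E).
have yn0 : y 0 0 != 0 by rewrite gt_eqF.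
by rewrite [LHS](partial_coordV l (- half_space_symbol k i j) yn0) opprK.
Qed.

Lemma half_space_symbolC (k i j : 'I_n.+1) :
  half_space_symbol k i j = half_space_symbol k j i.
Proof. by rewrite /half_space_symbol (eq_sym i j); ring. Qed.

Lemma half_space_symbol0 (k i : 'I_n.+1) :
  half_space_symbol k i 0 = (k == i)%:R.
Proof.
by rewrite /half_space_symbol eqxx mulr1 [X in _ + X - _]mulrC addrK.
Qed.

Lemma sum_half_space_symbol (i j : 'I_n.+1) (F : 'I_n.+1 -> R) :
  \sum_m half_space_symbol m i j * F m =
  (j == 0)%:R * F i + (i == 0)%:R * F j - (i == j)%:R * F 0.
Proof.
have D (a : 'I_n.+1) (c : R) : \sum_m (m == a)%:R * c * F m = c * F a.
  rewrite (bigD1 a) //= eqxx mul1r big1 ?addr0// => m ma.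
  by rewrite (negbTE ma) !mul0r.
rewrite -!D -big_split -sumrB; apply: eq_bigr => m _.
by rewrite /half_space_symbol /=; ring.
Qed.

(** After contraction, [d_j0 c^l_ik] and [d_i0 c^l_jk] cancel the two derivative terms, and the two
    terms with [d_k0] cancel by symmetry of [c] in its lower indices. What survives is
    [d_ik c^l_j0 - d_jk c^l_i0], where [c^l_i0 = d_li]. *)
Lemma riemann_half_space (l i j k : 'I_n.+1) (y : V) : 0 < y 0 0 ->
  riemann h l i j k y =
  - (y 0 0)^-1 ^+ 2 * ((l == i)%:R * (j == k)%:R - (l == j)%:R * (i == k)%:R).
Proof.
move=> y0; have yn0 : y 0 0 != 0 by rewrite gt_eqF.
rewrite /riemann !partial_christoffel_half_space //.
have -> : \sum_m (christoffel h m j k y * christoffel h l i m y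
             - christoffel h m i k y * christoffel h l j m y) =
    (y 0 0)^-1 ^+ 2 *
    (\sum_m half_space_symbol m j k * half_space_symbol l i m
     - \sum_m half_space_symbol m i k * half_space_symbol l j m).
  rewrite -sumrB mulr_sumr; apply: eq_bigr => m _.
  by rewrite !christoffel_half_space //; ring.
rewrite !sum_half_space_symbol !half_space_symbol0 (half_space_symbolC l j i).
by ring.
Qed.

Local Notation dotv v w := (\sum_i v 0 i * w 0 i : R).

(** As [- y_0^-2 <v, w> = kappa h(v, w)], this is the constant-curvature form [R(u, v) w = kappa
    (h(v, w) u - h(u, w) v)]. *)
Lemma curvature_vec_half_space (y u v w : V) : 0 < y 0 0 ->
  curvature_vec h y u v w =
  - (y 0 0)^-1 ^+ 2 *: (dotv v w *: u - dotv u w *: v).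
Proof.
move=> y0; apply/rowP => l; rewrite !mxE.
pose Y := - (y 0 0)^-1 ^+ 2.
have E i j k : u 0 i * v 0 j * w 0 k * riemann h l i j k y =
    Y * (u 0 i * (l == i)%:R * (v 0 j * w 0 k * (j == k)%:R)
         - u 0 i * w 0 k * (i == k)%:R * (v 0 j * (l == j)%:R)).
  by rewrite riemann_half_space // /Y; ring.
have D (a : 'I_n.+1) (F : 'I_n.+1 -> R) : \sum_m F m * (a == m)%:R = F a.
  rewrite (bigD1 a) //= eqxx mulr1 big1 ?addr0// => m ma.
  by rewrite eq_sym (negbTE ma) mulr0.
(* The Kronecker deltas are summed out from the innermost index [k] to the outermost [i]. *)
under eq_bigr => i _ do under eq_bigr => j _ do under eq_bigr => k _ do
  rewrite E.
under eq_bigr => i _ do under eq_bigr => j _ do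
  rewrite -mulr_sumr sumrB -mulr_sumr D -mulr_suml D.
under eq_bigr => i _ do rewrite -mulr_sumr sumrB -!mulr_sumr D.
rewrite -mulr_sumr sumrB -!mulr_suml D.
by rewrite /Y (mulrC (u 0 l)).
Qed.

Lemma half_space_metricE (y v w : V) :
  h y v w = (- kappa)^-1 * (y 0 0)^-1 ^+ 2 * dotv v w.
Proof. by rewrite /half_space_metric invfM exprVn. Qed.

Lemma dotv_ge0 (v : V) : 0 <= dotv v v.
Proof. by apply: sumr_ge0 => i _; rewrite -expr2 sqr_ge0. Qed.

Lemma dotv_eq0 (v : V) : (dotv v v == 0) = (v == 0).
Proof.
apply/eqP/eqP => [|->]; last by rewrite big1 // => i _; rewrite mxE mul0r.
move=> v0; apply/rowP => i; rewrite mxE.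
have H : forall j, true -> v 0 j * v 0 j = 0.
  by apply: psumr_eq0P v0 => j _; rewrite -expr2 sqr_ge0.
by apply/eqP; rewrite -sqrf_eq0 expr2 H.
Qed.

(** Strict Cauchy-Schwarz: [u], which is [<w, w>] times the component of [v] orthogonal to [w], has
    squared norm [<w, w>] times the Gram determinant. If that determinant vanished, [u = 0] would be
    a nontrivial linear relation. *)
Lemma dotv_gram_neq0 (v w : V) : row_free (col_mx v w) ->
  dotv v v * dotv w w - dotv v w ^+ 2 != 0.
Proof.
move=> vw.
(* The combination is the product of the row [(a, b)] with the stacked matrix, and row-freeness
   allows cancelling that matrix on the right. *)
have free (a b : R) : a *: v + b *: w = 0 -> a = 0 /\ b = 0.
  move=> ab.
  have : row_mx a%:M b%:M *m col_mx v w = 0.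
    by rewrite mul_row_col !mul_scalar_mx.
  move=> /(canRL (mulmxKp vw)); rewrite mul0mx -[RHS]row_mx0.
  move=> /eq_row_mx [/matrixP/(_ 0 0) + /matrixP/(_ 0 0)].
  by rewrite !mxE !mulr1n.
have w0 : dotv w w != 0.
  rewrite dotv_eq0; apply/eqP => w0.
  have [] := free 0 1; first by rewrite scale0r scale1r w0 addr0.
  by move=> _ /eqP; rewrite oner_eq0.
pose u := dotv w w *: v - dotv v w *: w.
have uE : dotv u u = dotv w w * (dotv v v * dotv w w - dotv v w ^+ 2).
  have -> : dotv u u = \sum_i (dotv w w ^+ 2 * (v 0 i * v 0 i)
      - 2 * dotv w w * dotv v w * (v 0 i * w 0 i)
      + dotv v w ^+ 2 * (w 0 i * w 0 i)).
    by apply: eq_bigr => i _; rewrite !mxE; ring.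
  by rewrite big_split sumrB /= -!mulr_sumr; ring.
apply/eqP => g0; move/eqP: uE; rewrite g0 mulr0 dotv_eq0 /u -scaleNr => /eqP.
by move=> /free [/eqP]; rewrite (negbTE w0).
Qed.

Lemma half_space_sectional_curvature :
  constant_sectional_curvature h (@half_space R n) kappa.
Proof.
move=> y y0 v w vw; have yn0 : y 0 0 != 0 by rewrite gt_eqF.
have g0 := dotv_gram_neq0 vw.
rewrite /sectional_curvature curvature_vec_half_space // !half_space_metricE.
have -> : dotv (- (y 0 0)^-1 ^+ 2 *: (dotv w w *: v - dotv v w *: w)) v =
    - (y 0 0)^-1 ^+ 2 * (dotv v v * dotv w w - dotv v w ^+ 2).
  rewrite (eq_bigr (fun i => - (y 0 0)^-1 ^+ 2 *
      (dotv w w * (v 0 i * v 0 i) - dotv v w * (v 0 i * w 0 i)))) => [|i _].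
    by rewrite -mulr_sumr sumrB -!mulr_sumr; ring.
  by rewrite !mxE; ring.
move: g0; set a := dotv v v; set b := dotv w w; set c := dotv v w => g0.
by field; rewrite yn0 kappa_neq0.
Qed.

End HyperbolicCurvature.

(** * Euclidean geometry of so3 *)

Section SkewGeometry.
Variable R : realType.
Implicit Types A B : so3 R.

Lemma so3_skew A i j : so3_mx A j i = - so3_mx A i j.
Proof.
case: A => M /= ; rewrite unfold_in => /eqP /matrixP /(_ i j).
by rewrite !mxE.
Qed.

(** Skewness of [B] absorbs the minus sign of the trace form; the resulting entrywise sum makes
    positivity visible. *)
Lemma so3_dotE A B :
  so3_dot A B = 2^-1 * \sum_i \sum_j so3_mx A i j * so3_mx B i j.
Proof.
rewrite /so3_dot mulNr -mulrN; congr (_ * _).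
rewrite /mxtrace -sumrN; apply: eq_bigr => i _.
rewrite mxE -sumrN; apply: eq_bigr => j _.
by rewrite (so3_skew B i j) mulrN opprK.
Qed.

Lemma so3_dotC A B : so3_dot A B = so3_dot B A.
Proof. by rewrite /so3_dot mxtrace_mulC. Qed.

Lemma so3_dotZr a A B : so3_dot A (a *: B) = a * so3_dot A B.
Proof. exact: linearZ. Qed.

Lemma so3_dotZl a A B : so3_dot (a *: A) B = a * so3_dot A B.
Proof. by rewrite so3_dotC so3_dotZr so3_dotC. Qed.

Lemma so3_dotDl A A' B : so3_dot (A + A') B = so3_dot A B + so3_dot A' B.
Proof. by rewrite so3_dotC linearD /= !(so3_dotC B). Qed.

Lemma so3_dot_ge0 A : 0 <= so3_dot A A.
Proof.
rewrite so3_dotE mulr_ge0 ?invr_ge0 ?ler0n //.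
by apply: sumr_ge0 => i _; apply: sumr_ge0 => j _; rewrite -expr2 sqr_ge0.
Qed.

Lemma so3_dot_eq0 A : so3_dot A A = 0 -> A = 0.
Proof.
rewrite so3_dotE => /eqP; rewrite mulf_eq0 invr_eq0 pnatr_eq0 /= => /eqP A0.
have sq i j : 0 <= so3_mx A i j * so3_mx A i j by rewrite -expr2 sqr_ge0.
have H i : true -> \sum_j so3_mx A i j * so3_mx A i j = 0.
  by apply: psumr_eq0P A0 i => i _; exact: sumr_ge0.
apply: val_inj; apply/matrixP => i j; rewrite [RHS]mxE.
apply/eqP; rewrite -sqrf_eq0 expr2; apply/eqP.
by apply: (psumr_eq0P _ (H i isT)) => // k _.
Qed.

Lemma so3_dot_gt0 A : A != 0 -> 0 < so3_dot A A.
Proof.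
move=> A0; rewrite lt_neqAle so3_dot_ge0 andbT eq_sym.
by apply: contra A0 => /eqP /so3_dot_eq0 ->.
Qed.

Lemma so3_mx_continuous : continuous (@so3_mx R).
Proof.
move=> A; apply/(@cvgrPdist_lt _ _ _ (nbhs A)) => e e0.
have := nbhsx_ballx A e e0; rewrite -ball_normE.
by apply: filterS => B.
Qed.

(** Continuity is read off as smoothness of order 0, so that the closure rules for smooth maps
    handle the entrywise sum. *)
Lemma so3_dot_continuous A : continuous (so3_dot A).
Proof.
have H : smooth_on setT (so3_dot A).
  apply: (@smooth_on_ext _ _ _ _
    (fun B => 2^-1 * \sum_i \sum_j so3_mx A i j * so3_mx B i j)) => //.
  - exact: openT.
  - by move=> B _; rewrite so3_dotE.
  apply: (smooth_onM openT); first exact: smooth_on_cst.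
  apply: (smooth_on_sum openT) => i; apply: (smooth_on_sum openT) => j.
  apply: (smooth_onM openT); first exact: smooth_on_cst.
  apply: smooth_on_linear; first by move=> a B B'; rewrite !mxE.
  move=> B; apply: (@continuous_comp _ _ _ (@so3_mx R) (fun M => M i j)).
    exact: so3_mx_continuous.
  exact: coord_continuous.
by move=> B; exact: (H 0%N).
Qed.

Section OrthonormalBasis.
Variable e : 'I_3 -> so3 R.
Hypothesis onb_e : orthonormal_basis e.

Lemma orthonormal_expansion A : A = \sum_i so3_dot (e i) A *: e i.
Proof.
have [ee /(_ A) [a ->]] := onb_e.
apply: eq_bigr => i _; congr (_ *: _).
rewrite linear_sum (bigD1 i) //= so3_dotZr ee eqxx mulr1 big1 ?addr0 // => j ji.
by rewrite so3_dotZr ee eq_sym (negbTE ji) mulr0.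
Qed.

Lemma so3_parseval A B :
  \sum_i so3_dot (e i) A * so3_dot (e i) B = so3_dot A B.
Proof.
rewrite [in RHS](orthonormal_expansion B) linear_sum.
by apply: eq_bigr => i _; rewrite /= so3_dotZr mulrC (so3_dotC A).
Qed.

End OrthonormalBasis.

(* Up to sign, the images of the standard basis of R^3 under the hat map; the
   index [k] is read modulo 3. *)
Fact hat_subproof (k : 'I_3) :
  delta_mx (k + 1) (k + 2) - delta_mx (k + 2) (k + 1) \in @skew_mx R.
Proof. by rewrite unfold_in linearB /= !trmx_delta opprB. Qed.

Definition hat_basis (k : 'I_3) : so3 R := SO3 (hat_subproof k).

(** The two nonzero entries of [hat_basis k] select opposite entries of [A]; by skewness they add up
    to twice one entry, and the [2^-1] of the inner product cancels the 2. *)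
Lemma so3_dot_hat k A : so3_dot (hat_basis k) A = so3_mx A (k + 1) (k + 2).
Proof.
have D (a b : 'I_3) (F : 'I_3 -> 'I_3 -> R) :
    \sum_i \sum_j (i == a)%:R * (j == b)%:R * F i j = F a b.
  rewrite (bigD1 a) //= [X in _ + X]big1 ?addr0 => [|i ia].
    rewrite (bigD1 b) //= !eqxx !mul1r big1 ?addr0 // => j jb.
    by rewrite (negbTE jb) mulr0 mul0r.
  by rewrite big1 // => j _; rewrite (negbTE ia) !mul0r.
rewrite so3_dotE.
under eq_bigr => i _ do under eq_bigr => j _ do
  rewrite !mxE -!mulnb !natrM mulrBl.
under eq_bigr => i _ do rewrite sumrB.
rewrite sumrB !D (so3_skew A (k + 1)) opprK.
by field.
Qed.

Lemma hat_basis_orthonormal : orthonormal_basis hat_basis.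
Proof.
have H k l : so3_dot (hat_basis k) (hat_basis l) = (k == l)%:R.
  rewrite so3_dot_hat !mxE.
  by move: k l; do 2![case=> [[|[|[|?]]] ?] //]; rewrite /= ?subr0 ?subrr.
split=> // A; exists (fun k => so3_dot (hat_basis k) A).
apply/eqP; rewrite -subr_eq0; apply/eqP.
(* [B] is the remainder after orthogonal projection; its pairings with the basis are its entries
   [(k + 1, k + 2)], all zero. *)
set B := A - _.
have B0 k : so3_mx B (k + 1) (k + 2) = 0.
  rewrite -so3_dot_hat linearB linear_sum (bigD1 k) //= so3_dotZr H eqxx mulr1.
  rewrite big1 ?addr0 ?subrr // => j jk.
  by rewrite so3_dotZr H eq_sym (negbTE jk) mulr0.
apply: val_inj; apply/matrixP => i j; rewrite [RHS]mxE.
(* Modulo 3, two indices are equal or one cyclic step apart. Diagonal entries vanish by skewness,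
   and the others are, up to sign, entries [(k + 1, k + 2)]. *)
have : [|| i == j, j == i + 1 | i == j + 1].
  by move: i j; do 2![case=> [[|[|[|?]]] ?] //].
have E (k : 'I_3) : (k - 1 + 1 = k) /\ (k - 1 + 2 = k + 1).
  by rewrite subrK; split=> //; rewrite -[2]/(1 + 1) addrA subrK.
case/or3P => /eqP ->.
- have /eqP := so3_skew B j j.
  by rewrite -addr_eq0 -mulr2n mulrn_eq0 /= => /eqP.
- by have := B0 (i - 1); rewrite (E i).1 (E i).2.
- by have := B0 (j - 1); rewrite (E j).1 (E j).2 (so3_skew B j) => ->;
    rewrite oppr0.
Qed.

End SkewGeometry.

(** * The rigid body metric *)

Section RigidBody.
Variables (R : realType) (C I : R).
Hypotheses (C_gt0 : 0 < C) (I_gt0 : 0 < I).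
Local Notation V := (R * so3 R)%type.
Implicit Types p v w : V.

Lemma open_body_space : open (@body_space R).
Proof.
apply: (@open_comp _ _ (@fst R (so3 R)) [set x | 0 < x]); last exact: open_gt.
by move=> p _; exact: cvg_fst.
Qed.

Lemma is_diff_fst p : is_diff p (fst : V -> R) fst.
Proof. by apply: is_diff_linear => // q; exact: cvg_fst. Qed.

Lemma is_diff_snd p : is_diff p (snd : V -> so3 R) snd.
Proof. by apply: is_diff_linear => // q; exact: cvg_snd. Qed.

Lemma dot_snd_linear (A : so3 R) : linear (fun p => so3_dot A p.2).
Proof. by move=> a p q; rewrite /= linearP. Qed.

Lemma dot_snd_continuous (A : so3 R) : continuous (fun p => so3_dot A p.2).
Proof.
move=> p; apply: (@continuous_comp _ _ _ (@snd R (so3 R)) (so3_dot A)).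
  exact: cvg_snd.
exact: so3_dot_continuous.
Qed.

Lemma is_diff_dot_snd (A : so3 R) p :
  is_diff p (fun q : V => so3_dot A q.2) (fun v => so3_dot A v.2).
Proof.
by apply: is_diff_linear; [exact: dot_snd_linear|exact: dot_snd_continuous].
Qed.

(** By Parseval in the hat basis, the squared norm is a sum of squares of continuous linear forms,
    each differentiated by the product rule. *)
Lemma is_diff_sqnorm_snd p :
  is_diff p (fun q : V => so3_dot q.2 q.2) (fun v => 2 * so3_dot p.2 v.2).
Proof.
have P := so3_parseval (hat_basis_orthonormal R).
have -> : (fun q : V => so3_dot q.2 q.2) = fun q =>
    \sum_i so3_dot (hat_basis R i) q.2 * so3_dot (hat_basis R i) q.2.
  by apply/funext => q; rewrite P.
apply: is_diff_eq (is_diff_sum (fun i => is_diffM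
  (is_diff_dot_snd (hat_basis R i) p) (is_diff_dot_snd (hat_basis R i) p))) _.
apply/funext => v; rewrite -P mulr_sumr; apply: eq_bigr => i _.
set a := so3_dot _ p.2; set b := so3_dot _ v.2.
by rewrite -[LHS]/(a * b + a * b); ring.
Qed.

Lemma is_diff_body_r p :
  is_diff p (@body_r R) (fun v => - (p.1 *: v.2 + v.1 *: p.2)).
Proof. exact: is_diffN (is_diff_scale (is_diff_fst p) (is_diff_snd p)). Qed.

Lemma is_diff_body_E p : p.1 != 0 ->
  is_diff p (body_E C I)
    (fun v => - C * p.1^-1 ^+ 2 * v.1 + I * so3_dot p.2 v.2).
Proof.
move=> p0.
apply: is_diff_eq (is_diffD (is_diffZ C (is_diffV p0 (is_diff_fst p)))
  (is_diffZ (2^-1 * I) (is_diff_sqnorm_snd p))) _.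
apply/funext => v; set a := so3_dot p.2 v.2.
rewrite -[LHS]/(C * (- p.1^-1 ^+ 2 * v.1) + 2^-1 * I * (2 * a)).
by field.
Qed.

Lemma body_metricE p v w : body_space p ->
  body_metric C I p v w =
  C * p.1^-1 ^+ 2 * (v.1 * w.1) + I * p.1 * so3_dot v.2 w.2.
Proof.
move=> p0; have pn0 : p.1 != 0 by rewrite gt_eqF.
have DM xi : is_diff p (fun q : V => body_M I q xi) (fun u => I * so3_dot u.2 xi).
  have -> : (fun q : V => body_M I q xi : R) = I *: (fun q => so3_dot xi q.2).
    by apply/funext => q; rewrite /body_M /= /body_M_fun so3_dotC.
  exact: is_diffZ (is_diff_dot_snd xi p).
have := is_diff_fst p; have := is_diff_body_E pn0; have := is_diff_body_r p.
rewrite /body_metric /diff_dual => -[_ ->] [_ ->] [_ Dfst].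
rewrite -[body_beta (R:=R)]/(fst : V -> R) Dfst.
(* The functional [dM(w)] is evaluated at the vector [dr(v)]. *)
have [_ ->] := DM (- (p.1 *: v.2 + v.1 *: p.2)).
rewrite linearN linearD /= !so3_dotZr (so3_dotC w.2 v.2) (so3_dotC w.2 p.2).
by ring.
Qed.

Lemma body_u_sqr p : body_space p -> body_u C p ^+ 2 = 4 * C / p.1.
Proof.
move=> p0; rewrite /body_u exprMn sqr_sqrtr ?divr_ge0 ?ltW //.
by rewrite -natrX mulrA.
Qed.

Lemma body_u_gt0 p : body_space p -> 0 < body_u C p.
Proof. by move=> p0; rewrite mulr_gt0 // sqrtr_gt0 divr_gt0. Qed.

Lemma is_diff_body_u p : body_space p ->
  is_diff p (body_u C) (fun v => - 2^-1 * p.1^-1 * body_u C p * v.1).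
Proof.
move=> p0; have pn0 : p.1 != 0 by rewrite gt_eqF.
have q0 : 0 < C / p.1 by rewrite divr_gt0.
have Dsqrt := is_derive1_is_diff (is_derive1_sqrt q0).
apply: is_diff_eq (is_diffZ 2 (is_diff_comp
  (is_diffZ C (is_diffV pn0 (is_diff_fst p))) Dsqrt)) _.
apply/funext => v; rewrite /body_u.
set s := Num.sqrt (C / p.1).
have sn0 : s != 0 by rewrite gt_eqF // sqrtr_gt0.
(* Eliminating [C] leaves a rational identity in [s] and [p.1]. *)
have CE : C = s ^+ 2 * p.1 by rewrite sqr_sqrtr ?ltW // divfK.
rewrite -[LHS]/(2 * ((C * (- p.1^-1 ^+ 2 * v.1)) * (2 * s)^-1)) {1}CE.
by field; rewrite sn0 pn0.
Qed.

Lemma smooth_fst (U : set V) : smooth_on U (fst : V -> R).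
Proof. by apply: smooth_on_linear => // p; exact: cvg_fst. Qed.

Lemma smooth_fstV : smooth_on (@body_space R) (fun p => p.1^-1).
Proof.
apply: (smooth_onV open_body_space); last exact: smooth_fst.
by move=> p p0; rewrite gt_eqF.
Qed.

Lemma smooth_body_u : smooth_on (@body_space R) (body_u C).
Proof.
apply: (smooth_on_diff open_body_space is_diff_body_u) => k Cu v.
apply: (@Ck_on_ext _ _ _ _ _
  (fun p => p.1^-1 *: (body_u C p *: (- 2^-1 * v.1 : R)))).
- exact: open_body_space.
- by move=> p _; rewrite /GRing.scale /=; ring.
apply: (Ck_onZ open_body_space); first exact: smooth_fstV.
by apply: (Ck_onZ open_body_space Cu); exact: Ck_on_cst.
Qed.

Lemma is_diff_body_omega (A : so3 R) p :
  is_diff p (fun q => so3_dot A (body_omega I q))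
    (fun v => Num.sqrt I * so3_dot A v.2).
Proof.
have -> : (fun q : V => so3_dot A (body_omega I q)) =
    Num.sqrt I *: (fun q => so3_dot A q.2).
  by apply/funext => q; rewrite so3_dotZr.
exact: is_diffZ (is_diff_dot_snd A p).
Qed.

(** * The conformal form and the chart onto the half-space *)

Section Chart.
Variable e : 'I_3 -> so3 R.
Hypothesis onb_e : orthonormal_basis e.

Lemma body_metric_conformal p v w : body_space p ->
  body_metric C I p v w =
  4 * C / body_u C p ^+ 2 *
  ('d (body_u C) p v * 'd (body_u C) p w +
   \sum_i 'd (fun q => so3_dot (e i) (body_omega I q)) p v *
          'd (fun q => so3_dot (e i) (body_omega I q)) p w).
Proof.
move=> p0; have pn0 : p.1 != 0 by rewrite gt_eqF.
have Cn0 : C != 0 by rewrite gt_eqF.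
under eq_bigr => i _.
  have [_ ->] := is_diff_body_omega (e i) p.
  rewrite mulrACA -expr2 sqr_sqrtr ?ltW //.
  over.
rewrite -mulr_sumr so3_parseval // body_metricE //.
have [_ ->] := is_diff_body_u p0.
(* Here [body_u] occurs only squared, so its value [4 C / beta] can be substituted; the conformal
   factor then equals [beta]. *)
transitivity (4 * C / body_u C p ^+ 2 *
  (4^-1 * p.1^-1 ^+ 2 * body_u C p ^+ 2 * (v.1 * w.1) + I * so3_dot v.2 w.2)).
  by rewrite body_u_sqr //; field; rewrite pn0 Cn0.
congr (_ * (_ + _)).
by field.
Qed.

(** Index 0, where [unlift] gives [None], has to carry the positive function [body_u], as it is the
    height coordinate of [half_space]. *)
Definition body_chart_coord (j : 'I_4) p : R :=
  if unlift 0 j is Some i then so3_dot (e i) (body_omega I p) else body_u C p.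

Definition body_chart p : 'rV[R]_4 := \row_j body_chart_coord j p.

(** The first component solves [y_0 = 2 sqrt(C / beta)] for [beta]; the second undoes the scaling by
    [sqrt I] and the expansion in the basis [e]. *)
Definition body_chart_inv (y : 'rV[R]_4) : V :=
  (4 * C * (y 0 0)^-1 ^+ 2,
   \sum_i ((Num.sqrt I)^-1 * y 0 (lift 0 i)) *: e i).

Lemma body_chart0 p : body_chart p 0 0 = body_u C p.
Proof. by rewrite mxE /body_chart_coord unlift_none. Qed.

Lemma body_chart_lift p i :
  body_chart p 0 (lift 0 i) = so3_dot (e i) (body_omega I p).
Proof. by rewrite mxE /body_chart_coord liftK. Qed.

Lemma smooth_body_chart : smooth_on (@body_space R) body_chart.
Proof.
apply: (smooth_on_row open_body_space) => j; rewrite /body_chart_coord.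
case: unliftP => [i _|_]; last exact: smooth_body_u.
under eq_fun do rewrite so3_dotZr.
apply: (smooth_onM open_body_space); first exact: smooth_on_cst.
by apply: smooth_on_linear;
  [exact: dot_snd_linear|exact: dot_snd_continuous].
Qed.

Lemma smooth_coord n (U : set 'rV[R]_n.+1) (j : 'I_n.+1) :
  smooth_on U (fun y : 'rV[R]_n.+1 => y 0 j).
Proof.
by apply: smooth_on_linear => [a u v|]; [rewrite !mxE|exact: coord_continuous].
Qed.

Lemma smooth_coordV n :
  smooth_on (@half_space R n) (fun y : 'rV[R]_n.+1 => (y 0 0)^-1).
Proof.
have oH := @open_half_space R n.
apply: (smooth_onV oH); last exact: smooth_coord.
by move=> y y0; rewrite gt_eqF.
Qed.

Lemma smooth_body_chart_inv : smooth_on (@half_space R 3) body_chart_inv.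
Proof.
have oH := @open_half_space R 3.
apply: (smooth_on_pair oH).
  apply: (smooth_onM oH); first exact: smooth_on_cst.
  by apply: (smooth_onM oH); exact: smooth_coordV.
apply: (smooth_on_sum oH) => i; apply: (smooth_onZ oH).
  by apply: (smooth_onM oH); [exact: smooth_on_cst|exact: smooth_coord].
exact: smooth_on_cst.
Qed.

Lemma body_chartK p : body_space p -> body_chart_inv (body_chart p) = p.
Proof.
move=> p0; have pn0 : p.1 != 0 by rewrite gt_eqF.
have Cn0 : C != 0 by rewrite gt_eqF.
have sI : Num.sqrt I != 0 by rewrite gt_eqF // sqrtr_gt0.
rewrite /body_chart_inv body_chart0 exprVn body_u_sqr //.
rewrite [p in RHS]surjective_pairing; congr (_, _).
  by field; rewrite pn0 Cn0.
rewrite [in RHS](orthonormal_expansion onb_e p.2).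
apply: eq_bigr => i _; rewrite body_chart_lift so3_dotZr.
by rewrite mulKf.
Qed.

Lemma body_chart_invK (y : 'rV[R]_4) : half_space y ->
  body_chart (body_chart_inv y) = y.
Proof.
move=> y0; have yn0 : y 0 0 != 0 by rewrite gt_eqF.
have Cn0 : C != 0 by rewrite gt_eqF.
have sI : Num.sqrt I != 0 by rewrite gt_eqF // sqrtr_gt0.
apply/rowP => j; case: (unliftP 0 j) => [i ->|->].
  rewrite body_chart_lift so3_dotZr /= linear_sum (bigD1 i) //= so3_dotZr.
  rewrite onb_e.1 eqxx mulr1 big1 ?addr0 => [|k ki].
    by rewrite mulVKf.
  by rewrite so3_dotZr onb_e.1 eq_sym (negbTE ki) mulr0.
rewrite body_chart0 /body_u /=.
(* The radicand is a perfect square, and positivity of [y 0 0] gives the sign of its root. *)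
have -> : C / (4 * C * (y 0 0)^-1 ^+ 2) = (y 0 0 / 2) ^+ 2.
  by field; rewrite yn0 Cn0.
rewrite sqrtr_sqr ger0_norm ?divr_ge0 ?ltW //.
by rewrite mulrC divfK.
Qed.

Lemma body_chart_isometry p v w : body_space p ->
  half_space_metric (- (4 * C)^-1) (body_chart p)
    ('d body_chart p v) ('d body_chart p w) = body_metric C I p v w.
Proof.
move=> p0; rewrite body_metric_conformal //.
have Dc : is_diff p body_chart
    (fun v => \row_j 'd (body_chart_coord j : V -> R) p v).
  apply: is_diff_row => j; apply: differentiableP; rewrite /body_chart_coord.
  case: unliftP => [i _|_]; first by have [] := is_diff_body_omega (e i) p.
  by have [] := is_diff_body_u p0.
(* For [kappa = - 1 / (4 C)] the factor of the half-space metric at height [u] is [4 C / u^2], the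
   conformal factor of the body metric. *)
rewrite diff_val half_space_metricE body_chart0 opprK invrK exprVn.
congr (_ * _); rewrite big_ord_recl !mxE /body_chart_coord unlift_none.
by congr (_ + _); apply: eq_bigr => i _; rewrite !mxE liftK.
Qed.

End Chart.

(** * Both metrics are Riemannian; conclusion *)

Lemma body_riemannian : riemannian_metric (@body_space R) (body_metric C I).
Proof.
split.
- move=> p p0 a u v w; rewrite !body_metricE //.
  rewrite -[(_ + _).1]/(a * u.1 + v.1) -[(_ + _).2]/(a *: u.2 + v.2).
  by rewrite so3_dotDl so3_dotZl; ring.
- by move=> p p0 v w; rewrite !body_metricE // so3_dotC (mulrC v.1).
- move=> p p0 [v1 v2] v0; rewrite body_metricE //=.
  have c0 : 0 < C * p.1^-1 ^+ 2 by rewrite mulr_gt0 // exprn_gt0 // invr_gt0.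
  have i0 : 0 < I * p.1 by rewrite mulr_gt0.
  (* Both coefficients are positive. If [v1] vanishes then [v2] does not, and the second term is
     positive; otherwise the first one is. *)
  have [v10|v10] := eqVneq v1 0.
    rewrite v10 mulr0 mulr0 add0r mulr_gt0 // so3_dot_gt0 //.
    by apply: contra v0 => /eqP ->; rewrite v10.
  apply: ltr_wpDr; first by rewrite mulr_ge0 ?so3_dot_ge0 // ltW.
  by rewrite mulr_gt0 // -expr2 exprn_even_gt0.
- move=> v w.
  apply: (@smooth_on_ext _ _ _ _ (fun p => C * (p.1^-1 * p.1^-1) * (v.1 * w.1)
    + I * p.1 * so3_dot v.2 w.2)); first exact: open_body_space.
    by move=> p p0; rewrite body_metricE.
  have oU := open_body_space.
  have sc (c : R) : smooth_on (@body_space R) (fun=> c) by exact: smooth_on_cst.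
  have sV := smooth_fstV.
  apply: (smooth_onD oU); apply: (smooth_onM oU) => //;
    apply: (smooth_onM oU) => //.
    exact: smooth_onM.
  exact: smooth_fst.
Qed.

End RigidBody.

Lemma half_space_riemannian (R : realType) (n : nat) (kappa : R) : kappa < 0 ->
  riemannian_metric (@half_space R n) (half_space_metric kappa).
Proof.
move=> k0; split.
- move=> y y0 a u v w; rewrite !half_space_metricE [X in _ = X + _]mulrCA -mulrDr.
  congr (_ * _); rewrite mulr_sumr -big_split; apply: eq_bigr => i _ /=.
  by rewrite !mxE; ring.
- move=> y y0 v w; rewrite !half_space_metricE; congr (_ * _).
  by apply: eq_bigr => i _; rewrite mulrC.
- move=> y y0 v v0; rewrite half_space_metricE.
  rewrite !mulr_gt0 ?invr_gt0 ?oppr_gt0 // ?exprn_gt0 ?invr_gt0 //.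
  by rewrite lt_neqAle dotv_ge0 andbT eq_sym dotv_eq0.
- move=> v w; under eq_fun do rewrite half_space_metricE expr2.
  have oH := @open_half_space R n.
  have sc (c : R) : smooth_on (@half_space R n) (fun=> c) by exact: smooth_on_cst.
  have sV := smooth_coordV R n.
  apply: (smooth_onM oH) => //; apply: (smooth_onM oH) => //.
  exact: smooth_onM.
Qed.

Theorem mainTheorem5 (R : realType) (C I : R) (C_gt0 : 0 < C) (I_gt0 : 0 < I) :
  [/\ (forall e : 'I_3 -> so3 R, orthonormal_basis e ->
        forall p : R * so3 R, body_space p -> forall v w : R * so3 R,
        body_metric C I p v w =
        4 * C / body_u C p ^+ 2 *
        ('d (body_u C) p v * 'd (body_u C) p w +
         \sum_i 'd (fun q => so3_dot (e i) (body_omega I q)) p v *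
                'd (fun q => so3_dot (e i) (body_omega I q)) p w)),
      isometric (@body_space R) (body_metric C I)
        (@half_space R 3) (half_space_metric (- (4 * C)^-1))
    & constant_sectional_curvature (half_space_metric (- (4 * C)^-1))
        (@half_space R 3) (- (4 * C)^-1)].
Proof.
have k0 : - (4 * C)^-1 < 0 by rewrite oppr_lt0 invr_gt0 mulr_gt0.
split.
- by move=> e onb_e p p0 v w; exact: body_metric_conformal.
(* The chart needs some orthonormal basis; the hat basis is an explicit one. *)
- have onb := hat_basis_orthonormal R.
  split; [exact: body_riemannian|exact: half_space_riemannian|].
  exists (body_chart C I (@hat_basis R)), (body_chart_inv C I (@hat_basis R)).
  split.
  + by split; [exact: smooth_body_chart|exact: smooth_body_chart_inv].
  + split=> [p p0|y y0]; first by rewrite /half_space /= body_chart0 body_u_gt0.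
    rewrite /body_space /=; apply: mulr_gt0; first by rewrite mulr_gt0.
    by rewrite exprn_gt0 // invr_gt0.
  + by split; [exact: body_chartK|exact: body_chart_invK].
  + by move=> p p0 v w; exact: body_chart_isometry.
- by apply: half_space_sectional_curvature; rewrite lt_eqF.
Qed.
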